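(* Let $A$ be an algebra over a field $F$. Then $c_n(A,q)=0$ for all $n\in\mathbb N$ and all $q\neq\operatorname{char}F$ (where $q$ is $0$ or a prime power $p^k$, $k\in\mathbb N$).
   Context: Rings and algebras are associative, not necessarily with unit; $\mathbb N=\{1,2,\dots\}$. An algebra over a field is regarded as a ring. $\mathbb Z\langle X\rangle$ is the free associative ring without $1$ on $X=\{x_1,x_2,\dots\}$. For a ring $R$, $\operatorname{Id}(R,\mathbb Z)\subseteq\mathbb Z\langle X\rangle$ is the set of $f$ with $f(a_1,\dots,a_n)=0$ for all $a_i\in R$. $P_n(\mathbb Z)$ is the additive subgroup of $\mathbb Z\langle X\rangle$ generated by $x_{\sigma(1)}\cdots x_{\sigma(n)}$, $\sigma\in S_n$. The codimensions $c_n(R,q)$, for $q=0$ or $q=p^k$ ($p$ prime, $k\in\mathbb N$), are the multiplicities in $$\frac{P_n(\mathbb Z)}{P_n(\mathbb Z)\cap\operatorname{Id}(R,\mathbb Z)}\cong \mathbb Z^{c_n(R,0)}\oplus\bigoplus_{p\text{ prime}}\bigoplus_{k\in\mathbb N}(\mathbb Z/p^k\mathbb Z)^{c_n(R,p^k)}.$$ *)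

(* Defs.v *)
From HB Require Import structures.
From mathcomp Require Import all_boot all_algebra.
From mathcomp Require Import finmap perm ring_quotient.
From mathcomp Require Import boolp.
From mathcomp.multinomials Require Import monalg.

Set Implicit Arguments.
Unset Strict Implicit.
Unset Printing Implicit Defensive.

Import GRing.Theory.

Local Open Scope ring_scope.

(* Associative rings and algebras, not necessarily with unit (MathComp's own
   ring structures all have a 1). *)

HB.mixin Record Zmodule_isNURing R of GRing.Zmodule R := {
  numul : R -> R -> R;
  numulA : associative numul;
  numulDl : left_distributive numul +%R;
  numulDr : right_distributive numul +%R
}.

#[short(type="nuRingType")]
HB.structure Definition NURing :=
  { R of GRing.Zmodule R & Zmodule_isNURing R }.

HB.mixin Record NURing_isNUAlgebra (F : fieldType) A
    of NURing A & GRing.Lmodule F A := {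
  nuscalerAl : forall (k : F) (x y : A), k *: numul x y = numul (k *: x) y;
  nuscalerAr : forall (k : F) (x y : A), k *: numul x y = numul x (k *: y)
}.

#[short(type="nuAlgType")]
HB.structure Definition NUAlgebra (F : fieldType) :=
  { A of NURing A & GRing.Lmodule F A & NURing_isNUAlgebra F A }.

(* The free associative ring with 1 on countably many variables; the variable
   x_(i+1) of the usual numbering is [fvar i].  The free ring without 1 is the
   set [freeNU] of its elements with zero constant term. *)

Notation freeRing := {malg int[{fmonom nat}]}.

Definition fvar (i : nat) : freeRing := << fmu i >>.

Definition freeNU : {pred freeRing} := [pred f : freeRing | f@_(mone : {fmonom nat}) == 0].

Section Identities.
Variable R : nuRingType.

(* The value a_i1 a_i2 ... a_im of a word.  The empty word is not an element of
   the free ring without 1, so that its value 0 below plays no role. *)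
Definition wordval (a : nat -> R) (w : seq nat) : R :=
  if w is i :: s then foldl (fun y j => numul y (a j)) (a i) s else 0.

Definition evalNU (a : nat -> R) (f : freeRing) : R :=
  \sum_(w <- msupp f) wordval a w *~ f@_w.

(* As f has finitely many variables, a tuple (a_1, ..., a_n) of arguments may be
   replaced with an assignment of a value to every variable. *)
Definition IdZ : {pred freeRing} :=
  [pred f : freeRing | (f \in freeNU) && `[< forall a : nat -> R, evalNU a f = 0 >]].

Lemma evalNU_is_additive a : zmod_morphism (evalNU a).
Proof.
move=> f g.
have evalE (E : {fset {fmonom nat}}) (h : freeRing) : (msupp h `<=` E)%fset ->
    evalNU a h = \sum_(w <- E) wordval a w *~ h@_w.
  move=> le; rewrite /evalNU (big_fset_incl _ le) // => w _ /mcoeff_outdom ->.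
  by rewrite mulr0z.
pose E := (msupp f `|` msupp g `|` msupp (f - g))%fset.
have [fE gE fgE] : [/\ msupp f `<=` E, msupp g `<=` E & msupp (f - g) `<=` E]%fset.
  by split; apply/fsubsetP => w wE; rewrite !in_fsetU wE ?orbT.
rewrite !(evalE E) //.
by rewrite -sumrB; apply: eq_bigr => w _; rewrite mcoeffB mulrzBr.
Qed.

HB.instance Definition _ a :=
  GRing.isZmodMorphism.Build freeRing R (evalNU a) (evalNU_is_additive a).

Lemma IdZ_zmod_closed : zmod_closed IdZ.
Proof.
split=> [|f g]; rewrite !inE.
  by rewrite mcoeff0 eqxx; apply/asboolP => a; rewrite raddf0.
case/andP=> /eqP f0 /asboolP fR /andP[/eqP g0 /asboolP gR].
rewrite mcoeffB f0 g0 subrr eqxx /=; apply/asboolP => a.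
by rewrite raddfB /= fR gR subrr.
Qed.

End Identities.

Definition zspan (V : zmodType) (S : V -> Prop) : {pred V} :=
  [pred v : V | `[< forall H : {pred V},
                      zmod_closed H -> (forall s, S s -> s \in H) -> v \in H >]].

Lemma zspan_zmod_closed (V : zmodType) (S : V -> Prop) : zmod_closed (zspan S).
Proof.
split=> [|u v]; rewrite !inE; first by apply/asboolP => H [].
move=> /asboolP uS /asboolP vS; apply/asboolP => H HZ HS.
by case: (HZ) => _; apply; [apply: uS | apply: vS].
Qed.

Section Multilinear.
Variable n : nat.

Definition multilinear_monomial (s : 'S_n) : freeRing :=
  \prod_(i < n) fvar (s i).

Definition PZ : {pred freeRing} :=
  zspan (fun f => exists s : 'S_n, f = multilinear_monomial s).

HB.instance Definition _ :=
  GRing.isZmodClosed.Build freeRing PZ (zspan_zmod_closed _).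

Definition PZ_group := {f : freeRing | f \in PZ}.

HB.instance Definition _ := [isSub of PZ_group for sval].
HB.instance Definition _ := [Choice of PZ_group by <:].
HB.instance Definition _ := [SubChoice_isSubZmodule of PZ_group by <:].

Variable R : nuRingType.

Definition PZ_Id : {pred PZ_group} := [pred f : PZ_group | val f \in IdZ R].

Lemma PZ_Id_zmod_closed : zmod_closed PZ_Id.
Proof.
have [Id0 IdB] := IdZ_zmod_closed R.
split=> [|f g fId gId]; first by rewrite unfold_in /= Id0.
by rewrite unfold_in /= (IdB _ _ fId gId).
Qed.

HB.instance Definition _ :=
  GRing.isZmodClosed.Build PZ_group PZ_Id PZ_Id_zmod_closed.

Definition PZ_quot : zmodType := Quotient.quot PZ_Id.

End Multilinear.

Record dsum (J : eqType) (G : J -> zmodType) := DSum {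
  dsum_val :> forall j, G j;
  dsum_fin : exists s : seq J, forall j, j \notin s -> dsum_val j = 0
}.

Section DirectSum.
Variables (J : eqType) (G : J -> zmodType).
Implicit Types x y z : dsum G.

HB.instance Definition _ := gen_eqMixin (dsum G).
HB.instance Definition _ := gen_choiceMixin (dsum G).

Lemma dsumP x y : (forall j, x j = y j) -> x = y.
Proof.
case: x y => [x xP] [y yP] /= eq_xy.
have {}eq_xy : x = y by apply: functional_extensionality_dep.
by case: y / eq_xy yP => yP; congr DSum; apply: Prop_irrelevance.
Qed.

Lemma dsum0_fin : exists s : seq J, forall j, j \notin s -> (0 : G j) = 0.
Proof. by exists [::]. Qed.

Lemma dsumN_fin x : exists s : seq J, forall j, j \notin s -> - x j = 0.
Proof. by case: (dsum_fin x) => s xs; exists s => j /xs ->; rewrite oppr0. Qed.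

Lemma dsumD_fin x y : exists s : seq J, forall j, j \notin s -> x j + y j = 0.
Proof.
case: (dsum_fin x) (dsum_fin y) => [s xs] [t yt]; exists (s ++ t) => j.
by rewrite mem_cat negb_or => /andP[/xs -> /yt ->]; rewrite addr0.
Qed.

Definition dsum0 : dsum G := DSum dsum0_fin.
Definition dsumN x : dsum G := DSum (dsumN_fin x).
Definition dsumD x y : dsum G := DSum (dsumD_fin x y).

Lemma dsumDA : associative dsumD.
Proof. by move=> x y z; apply: dsumP => j /=; rewrite addrA. Qed.

Lemma dsumDC : commutative dsumD.
Proof. by move=> x y; apply: dsumP => j /=; rewrite addrC. Qed.

Lemma dsum0D : left_id dsum0 dsumD.
Proof. by move=> x; apply: dsumP => j /=; rewrite add0r. Qed.

Lemma dsumND : left_inverse dsum0 dsumN dsumD.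
Proof. by move=> x; apply: dsumP => j /=; rewrite addNr. Qed.

HB.instance Definition _ :=
  GRing.isZmodule.Build (dsum G) dsumDA dsumDC dsum0D dsumND.

End DirectSum.

(* A summand of the torsion part is given by (p, k, i), with p prime, and i < c
   (p ^ k.+1); the shift of k makes the exponents range over 1, 2, ... *)

Definition prime_nat := {p : nat | prime p}.

Definition prime_pow (pk : prime_nat * nat) : nat := (val pk.1 ^ pk.2.+1)%N.

Definition tors_idx (c : nat -> nat) :=
  {pk : prime_nat * nat & 'I_(c (prime_pow pk))}.

Definition tors_part (c : nat -> nat) : zmodType :=
  dsum (fun j : tors_idx c => 'Z_(prime_pow (tag j)) : zmodType).

Definition free_part (c : nat -> nat) : zmodType := {ffun 'I_(c 0%N) -> int}.

Definition zmod_isog (U V : zmodType) : Prop :=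
  exists f : {additive U -> V}, bijective f.

(* c has no meaning at arguments other than 0 and the prime powers. *)
Definition is_codim (R : nuRingType) (n : nat) (c : nat -> nat) : Prop :=
  zmod_isog (PZ_quot n R) (free_part c * tors_part c)%type.

(* Such a c exists, and is unique on 0 and the prime powers, by the structure
   theorem of finitely generated abelian groups.  The default value is nonzero,
   so that no vanishing result can hold by default. *)
Definition codim (R : nuRingType) (n : nat) : nat -> nat :=
  if pselect (exists c, is_codim R n c) is left ex then projT1 (cid ex)
  else fun=> 1%N.

Definition is_char (F : fieldType) (q : nat) : Prop :=
  if q is 0 then [pchar F] =i pred0 else q \in [pchar F].

Definition zero_or_prime_pow (q : nat) : Prop :=
  q = 0%N \/ exists p k : nat, [/\ prime p, (0 < k)%N & q = (p ^ k)%N].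

(* Main.v *)
From HB Require Import structures.
Require Import Defs.
From mathcomp Require Import all_boot all_algebra.
From mathcomp Require Import perm ring_quotient boolp zify.
From mathcomp.multinomials Require Import monalg.

Set Implicit Arguments.
Unset Strict Implicit.
Unset Printing Implicit Defensive.

Import GRing.Theory Num.Theory.

Local Open Scope ring_scope.

(** The group G = P_n(Z) / (P_n(Z) :&: Id(A, Z)) looks like a free module over
    the prime ring of F, for the following reason. An identity of A is a
    polynomial f with all values f(a) = 0 in the F-space A, and z f has the
    values z f(a). Hence a class x of G satisfies z x = 0 exactly if x = 0 or z
    = 0 in F ([PZ_quot_char_torsion]); so G is torsion-free if char F = 0, and
    is killed by p if char F = p. The hypothesis n > 0 enters here: for n = 0
    the constant polynomials would not be in the free ring without 1.

    A direct sum of copies of Z and of Z/p^k with this property has only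
    summands Z if char F = 0, and only summands Z/p if char F = p, as the
    generator of any other summand violates the property
    ([zero_char_of_free_part], [prime_pow_char_of_tors_part]). So every
    decomposition of G has the required vanishing multiplicities.

    As [codim] takes a default value if no decomposition is available, one must
    also prove that G decomposes. It is generated by the classes of the n!
    monomials, and both characteristics can be treated at once: a generating
    family with a relation that is nontrivial in F can be made shorter by a
    Euclidean descent on the coefficients ([spans_shrink]). A family which
    cannot be shortened gives a surjection Z^m -> G whose kernel consists of the
    vectors that vanish in F ([spans_basis]), and so does an explicit surjection
    of Z^m onto Z^m or (Z/p)^m ([presents_char0], [presents_charp]). Quotients
    by the same kernel are isomorphic ([zmod_isog_same_kernel]). *)

(** * Groups with the torsion of a field *)

(** The common property of vector spaces over F and of their subgroups, by which
    the cases of characteristic 0 and p are treated together. *)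
Definition char_torsion (F : fieldType) (G : zmodType) : Prop :=
  forall (x : G) (z : int), x *~ z = 0 <-> x = 0 \/ z%:~R = 0 :> F.

Definition spans (N : nat) (G : zmodType) (g : 'I_N -> G) : Prop :=
  forall x : G, exists a : 'I_N -> int, x = \sum_i g i *~ a i.

Lemma char_torsion_isog (F : fieldType) (U V : zmodType) :
  zmod_isog U V -> char_torsion F U -> char_torsion F V.
Proof.
case=> f [g fK gK] UF y z; have f_inj := can_inj fK.
have f0 x : f x = 0 <-> x = 0.
  by split=> [|->]; rewrite ?raddf0 // -[0 in X in X -> _](raddf0 f) => /f_inj.
by rewrite -(gK y) -raddfMz !f0.
Qed.

Lemma zmod_isog_same_kernel (W G V : zmodType) (f : W -> G) (h : W -> V) :
    zmod_morphism f -> zmod_morphism h ->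
    (forall x, exists w, f w = x) -> (forall y, exists w, h w = y) ->
    (forall w, f w = 0 <-> h w = 0) ->
  zmod_isog G V.
Proof.
move=> fB hB fS hS fh.
have fhE w w' : f w = f w' <-> h w = h w'.
  split=> /eqP; rewrite -subr_eq0 => /eqP e; apply/eqP; rewrite -subr_eq0.
    by rewrite -hB; apply/eqP/fh; rewrite fB.
  by rewrite -fB; apply/eqP/fh; rewrite hB.
pose s x := sval (cid (fS x)); pose t y := sval (cid (hS y)).
have sK x : f (s x) = x by rewrite /s; case: cid.
have tK y : h (t y) = y by rewrite /t; case: cid.
have hsB : zmod_morphism (h \o s).
  by move=> x y /=; rewrite -hB; apply/fhE; rewrite fB !sK.
pose phi : {additive G -> V} :=
  HB.pack (h \o s) (GRing.isZmodMorphism.Build G V (h \o s) hsB).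
exists phi; exists (f \o t) => x /=.
  by rewrite -[RHS]sK; apply/fhE; rewrite tK.
by rewrite -[RHS]tK; apply/fhE; rewrite sK.
Qed.

(** * Bases of finitely generated groups *)

Section Basis.
Variables (F : fieldType) (G : zmodType).
Hypothesis GF : char_torsion F G.

(** Adding e times g i to the generator g j is compensated by subtracting e times
    the coefficient b j from b i.  This serves to carry over both a relation and
    the expansion of an arbitrary element to the new generators. *)
Lemma sum_transvection N (g : 'I_N -> G) (i j : 'I_N) (e : int)
    (b : 'I_N -> int) : i != j ->
  \sum_k (if k == j then g j + g i *~ e else g k)
         *~ (if k == i then b i - e * b j else b k) = \sum_k g k *~ b k.
Proof.
move=> nij; have nji : j != i by rewrite eq_sym.
rewrite (bigD1 i isT) (bigD1 j nji) [RHS](bigD1 i isT) [in RHS](bigD1 j nji).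
rewrite !eqxx (negPf nij) (negPf nji) /= !addrA; congr (_ + _).
  by rewrite mulrzBr mulrzDl mulrzA [g j *~ _ + _]addrC addrA subrK.
by apply: eq_bigr => k /andP[/negPf -> /negPf ->].
Qed.

(** If a single coefficient a i is nonzero in F, then the relation reduces to
    g i *~ a i = 0, whence g i = 0 and this generator can be dropped.  If two of
    them are, then one step of the Euclidean algorithm on the coefficients, as a
    change of generators, decreases the sum of the absolute values; the smaller
    coefficient is unchanged, and so the new relation is still nontrivial in F. *)
Lemma spans_shrink d N (g : 'I_N.+1 -> G) (a : 'I_N.+1 -> int) (i : 'I_N.+1) :
    (\sum_k `|a k|%N <= d)%N -> spans g -> \sum_k g k *~ a k = 0 ->
    (a i)%:~R != 0 :> F ->
  exists g' : 'I_N -> G, spans g'.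
Proof.
elim: d g a i => [|d IHd] g a i le_d gS ga0 ai0.
  case/eqP: ai0; move: le_d; rewrite leqn0 sum_nat_eq0 => /forallP/(_ i).
  by rewrite /= absz_eq0 => /eqP ->.
have [[j nij aj0]|allz] := pselect (exists2 j, i != j & (a j)%:~R != 0 :> F);
  last first.
  (* The other terms of the relation vanish, as their coefficients do in F. *)
  have gi0 : g i = 0.
    move: ga0; rewrite (bigD1 i) //= big1 ?addr0; last first.
      move=> k nki; apply/GF; right; apply/eqP/negPn/negP => ak0.
      by apply: allz; exists k; rewrite // eq_sym.
    by case/GF => // /eqP; rewrite (negPf ai0).
  exists (g \o lift i) => x; have [b ->] := gS x.
  exists (b \o lift i); rewrite (bigD1_ord i) //= gi0 mul0rz add0r.
  by apply: eq_bigr.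
wlog le_a : i j ai0 aj0 nij / (`|a j| <= `|a i|)%N.
  move=> wl; have [le|/ltnW le] := leqP `|a j|%N `|a i|%N; first exact: (wl i j).
  by apply: (wl j i); rewrite // eq_sym.
have [e lt_e] : exists e : int, (`|(a i - e * a j)%R| < `|a i|)%N.
  have aj_gt0 : (0 < `|a j|)%N.
    by rewrite absz_gt0; apply: contraNneq aj0 => ->.
  (* With e the sign of a i * a j, the new coefficient is |a i| - |a j| in
     absolute value. *)
  exists (if (0 <= a i) == (0 <= a j) then 1 else -1).
  by case: ifP; lia.
pose g' k := if k == j then g j + g i *~ e else g k.
pose sh (b : 'I_N.+1 -> int) k := if k == i then b i - e * b j else b k.
apply: (IHd g' (sh a) j).
- rewrite -ltnS (leq_trans _ le_d) // [X in (_ <= X)%N](bigD1 i) //=.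
  rewrite (bigD1 i) //= {1}/sh eqxx -addSn leq_add //.
  by apply: leq_sum => k /negPf nki; rewrite /sh nki.
- move=> x; have [b ->] := gS x; exists (sh b).
  by rewrite sum_transvection.
- by rewrite sum_transvection.
- by rewrite /sh (eq_sym j) (negPf nij).
Qed.

Lemma spans_basis N (g : 'I_N -> G) : spans g ->
  exists m, exists2 h : 'I_m -> G, spans h &
    forall a : 'I_m -> int,
      \sum_i h i *~ a i = 0 <-> forall i, (a i)%:~R = 0 :> F.
Proof.
elim: N g => [|N IHN] g gS.
  by exists 0%N, g => // a; split=> [_ []|_] //; rewrite big_ord0.
have [[a ga0 [i ai0]]|noa] := pselect
  (exists2 a, \sum_i g i *~ a i = 0 & exists i, (a i)%:~R != 0 :> F).
  by have [g' /IHN] := spans_shrink (leqnn _) gS ga0 ai0.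
exists N.+1, g => // a; split=> [ga0 i|a0]; last first.
  by apply: big1 => i _; apply/GF; right.
by apply/eqP/negPn/negP => ai0; apply: noa; exists a => //; exists i.
Qed.

End Basis.

(** * The group of multilinear polynomials modulo identities *)

Section MultilinearQuotient.
Variable n : nat.

Lemma PZ_sub_freeNU f : (0 < n)%N -> f \in PZ n -> f \in freeNU.
Proof.
move=> n_gt0 /asboolP; apply=> [|_ [s ->]].
  split=> [|u v]; rewrite !inE ?mcoeff0 // => /eqP u0 /eqP v0.
  by rewrite mcoeffB u0 v0 subrr.
rewrite inE /multilinear_monomial (rmorph_prod (mcoeff (mone : {fmonom nat}))).
by rewrite (bigD1 (Ordinal n_gt0)) //= /fvar mcoeffU fmP fmU fm1 mul0r.
Qed.

Variable R : nuRingType.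

Definition PZ_proj : PZ_group n -> PZ_quot n R := (\pi_(PZ_quot n R))%qT.

Lemma PZ_proj_is_zmod_morphism : zmod_morphism PZ_proj.
Proof. by move=> u v; rewrite /PZ_proj raddfB. Qed.

HB.instance Definition _ := GRing.isZmodMorphism.Build
  (PZ_group n) (PZ_quot n R) PZ_proj PZ_proj_is_zmod_morphism.

Lemma PZ_proj_eq0 u : (PZ_proj u == 0) = (val u \in IdZ R).
Proof.
have -> : 0 = PZ_proj 0 by rewrite raddf0.
by rewrite /PZ_proj -Quotient.idealrBE subr0.
Qed.

Lemma PZ_proj_surj x : exists u, PZ_proj u = x.
Proof.
exists (generic_quotient.repr x).
by rewrite /PZ_proj generic_quotient.reprK.
Qed.

Lemma PZ_quot_spans : exists N, exists g : 'I_N -> PZ_quot n R, spans g.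
Proof.
have mP (s : 'S_n) : multilinear_monomial s \in PZ n.
  by apply/asboolP => H _; apply; exists s.
pose m s : PZ_group n := Sub (multilinear_monomial s) (mP s).
exists #|{: 'S_n}|, (PZ_proj \o m \o enum_val) => x.
have [u <-] := PZ_proj_surj x.
have [a uE] : exists a : 'S_n -> int,
    val u = \sum_s multilinear_monomial s *~ a s.
  have /asboolP PuZ := valP u.
  pose H : {pred freeRing} := [pred f | `[< exists a : 'S_n -> int,
    f = \sum_s multilinear_monomial s *~ a s >]].
  apply/asboolP/(PuZ H) => [|_ [s ->]].
    split=> [|f g /asboolP[a ->] /asboolP[b ->]]; apply/asboolP.
      by exists (fun=> 0); rewrite big1.
    exists (fun s => a s - b s); rewrite -sumrB.
    by apply: eq_bigr => s _; rewrite mulrzBr.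
  apply/asboolP; exists (fun t => (t == s)%:Z); rewrite (bigD1 s) //= eqxx.
  by rewrite big1 ?addr0 // => t /negPf ->.
exists (a \o enum_val).
have -> : u = \sum_s m s *~ a s.
  apply: val_inj; rewrite uE raddf_sum; apply: eq_bigr => s _.
  by rewrite raddfMz.
rewrite raddf_sum (reindex _ (onW_bij _ (enum_val_bij _))) /=.
by apply: eq_bigr => i _; rewrite raddfMz.
Qed.

End MultilinearQuotient.

(** The integer z acts on the values of a polynomial as the scalar z of F, which
    is zero or invertible. *)
Lemma PZ_quot_char_torsion (F : fieldType) (A : nuAlgType F) n :
  (0 < n)%N -> char_torsion F (PZ_quot n A).
Proof.
move=> n_gt0 x z; have [u <-] := PZ_proj_surj x.
have inId (w : PZ_group n) :
    PZ_proj A w = 0 <-> forall a : nat -> A, evalNU a (val w) = 0.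
  have wNU := PZ_sub_freeNU n_gt0 (valP w).
  split=> [/eqP|w0]; last first.
    by apply/eqP; rewrite PZ_proj_eq0 inE wNU /=; apply/asboolP.
  by rewrite PZ_proj_eq0 inE wNU => /asboolP.
rewrite -raddfMz !inId.
have evalM a : evalNU a (val (u *~ z)) = z%:~R *: evalNU a (val u) :> A.
  by rewrite (raddfMz val) raddfMz scaler_int.
split=> [uz0|[u0|z0] a]; last 2 first.
- by rewrite evalM u0 scaler0.
- by rewrite evalM z0 scale0r.
have [z0|nz0] := eqVneq (z%:~R : F) 0; [by right | left=> a].
by apply/eqP; have /eqP := uz0 a; rewrite evalM scaler_eq0 (negPf nz0).
Qed.

(** * Multiplicities in a direct sum of cyclic groups *)

(** A summand Z has an element of infinite order, which excludes a positive
    characteristic. *)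
Lemma zero_char_of_free_part (F : fieldType) (c : nat -> nat) :
    char_torsion F (free_part c * tors_part c)%type -> (0 < c 0)%N ->
  is_char F 0.
Proof.
move=> VF c0 p; rewrite inE; apply/negP => pF.
pose x : free_part c * tors_part c := ([ffun=> 1], 0).
have /(congr1 fst)/ffunP/(_ (Ordinal c0)) : x *~ p = 0.
  by apply/VF; right; apply: pcharf0.
rewrite -pmulrn (raddfMn fst) ffunMnE !ffunE => /eqP.
by rewrite pnatr_eq0; case: p pF => [|p] /andP[].
Qed.

Lemma natr_Zp_eq0 (q m : nat) : (1 < q)%N -> (m%:R == 0 :> 'Z_q) = (q %| m)%N.
Proof. by move=> q_gt1; rewrite -val_eqE /= val_Zp_nat. Qed.

Lemma val_dsumMn (J : eqType) (G : J -> zmodType) (x : dsum G) k j :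
  (x *+ k) j = x j *+ k.
Proof. by elim: k => // k IHk; rewrite !mulrS -IHk. Qed.

(** The generator of a summand Z/q with q = p^(k+1) has order q.  So an integer is
    zero in F exactly if q divides it; then p is zero in F, as p^(k+1) is, and
    therefore q divides p. *)
Lemma prime_pow_char_of_tors_part (F : fieldType) (c : nat -> nat) (p k : nat) :
    char_torsion F (free_part c * tors_part c)%type -> prime p ->
    (0 < c (p ^ k.+1))%N ->
  is_char F (p ^ k.+1).
Proof.
move=> VF p_pr cq; set q := (p ^ k.+1)%N.
have q_gt1 : (1 < q)%N by rewrite -(exp1n k.+1) ltn_exp2r // prime_gt1.
pose pk : prime_nat * nat := (exist _ p p_pr, k).
pose j : tors_idx c := existT _ pk (Ordinal cq).
have e_fin : exists s : seq (tors_idx c), forall j', j' \notin s ->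
    (if j' == j then 1 else 0) = 0 :> 'Z_(prime_pow (tag j')).
  by exists [:: j] => j'; rewrite inE => /negPf ->.
pose e : tors_part c := DSum e_fin.
pose x : free_part c * tors_part c := (0, e).
have xM m : x *+ m = (0, e *+ m).
  by elim: m => [|m IHm]; rewrite ?mulr0n // !mulrS IHm /= -[LHS]/(_, _) /= addr0.
have xM0 (m : nat) : x *+ m = 0 <-> (q %| m)%N.
  rewrite xM; split=> [/(congr1 snd)/= /(congr1 (fun y : dsum _ => y j))|].
    by rewrite val_dsumMn /= eqxx => /eqP; rewrite natr_Zp_eq0.
  move=> qm; congr pair; apply: dsumP => j'; rewrite val_dsumMn /=.
  case: eqP => [->|_]; last by rewrite mul0rn.
  by apply/eqP; rewrite natr_Zp_eq0.
have x_neq0 : x <> 0.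
  by rewrite -[x]mulr1n xM0 dvdn1 => /eqP q1; rewrite q1 in q_gt1.
have xMF (m : nat) : (q %| m)%N <-> m%:R = 0 :> F.
  rewrite -xM0 [x *+ m]pmulrn (VF x m); split=> [[]//|m0]; by right.
have pF : p \in [pchar F].
  rewrite inE p_pr; have /eqP := (xMF q).1 (dvdnn q).
  by rewrite /q natrX expf_eq0.
have := (xMF p).2 (pcharf0 pF).
rewrite /q expnS -{3}[p]muln1 dvdn_pmul2l ?prime_gt0 // dvdn1 => /eqP ->.
by rewrite muln1; case: (p) pF.
Qed.

(** * Existence of the decomposition *)

(** For char F = 0 the kernel is trivial, and G is Z^m; for char F = p the kernel
    is p Z^m, and G is (Z/p)^m. *)
Definition presents (F : fieldType) (m : nat) (G : zmodType)
    (f : {ffun 'I_m -> int} -> G) : Prop :=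
  [/\ zmod_morphism f, forall x, exists a, f a = x &
      forall a, f a = 0 <-> forall i, (a i)%:~R = 0 :> F].

Lemma intr_eq0_char0 (F : fieldType) (z : int) :
  [pchar F] =i pred0 -> z%:~R = 0 :> F -> z = 0.
Proof.
move=> F0 z0; apply/eqP/negPn/negP => nz.
have : (`|z|%N)%:R == 0 :> F.
  by move: z0; case: (z) => k /eqP //; rewrite NegzE rmorphN oppr_eq0.
by case/natf0_pchar => [|p]; rewrite ?absz_gt0 // F0.
Qed.

Lemma presents_char0 (F : fieldType) (m : nat) : [pchar F] =i pred0 ->
  exists c, exists f, @presents F m (free_part c * tors_part c)%type f.
Proof.
move=> F0; pose c q := if q is 0 then m else 0%N; exists c.
pose f (a : {ffun 'I_m -> int}) : free_part c * tors_part c := (a, 0).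
have tors0 (y : tors_part c) : y = 0.
  apply: dsumP; case=> -[[p p_pr] k] /= [i i_lt]; exfalso.
  have: (0 < prime_pow (exist _ p p_pr, k))%N by rewrite expn_gt0 prime_gt0.
  by case: (prime_pow _) i_lt.
exists f; split=> [a b|[a y]|a].
- by rewrite /f; congr pair; rewrite subr0.
- by exists a; rewrite /f (tors0 y).
split=> [[->] i|a0]; first by rewrite ffunE.
by congr pair; apply/ffunP => i; rewrite ffunE; apply: (intr_eq0_char0 F0).
Qed.

Lemma presents_charp (F : fieldType) (m p : nat) : p \in [pchar F] ->
  exists c, exists f, @presents F m (free_part c * tors_part c)%type f.
Proof.
move=> pF; have p_pr := pcharf_prime pF; have p_gt1 := prime_gt1 p_pr.
pose c q := if q == p then m else 0%N; exists c.
pose P : prime_nat * nat := (exist _ p p_pr, 0%N).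
have prime_powP pk (i : 'I_(c (prime_pow pk))) : pk = P.
  case: pk i => -[p' p'_pr] k [i]; rewrite /c /prime_pow /=.
  case: eqP => // e _; have p'E : p' = p.
    have : (p' %| p)%N by rewrite -e expnS dvdn_mulr.
    by rewrite dvdn_prime2 // => /eqP.
  subst p'; move/eqP: e; rewrite -[X in _ == X]expn1 eqn_exp2l // => /eqP[->].
  by congr (exist _ _ _, _); apply: Prop_irrelevance.
have cP : c (prime_pow P) = m by rewrite /c /prime_pow /= expn1 eqxx.
have c_le q : (c q <= m)%N by rewrite /c; case: eqP.
(* The index set of the torsion part is 'I_m, via the inverse bijections J
   and pos. *)
pose pos (j : tors_idx c) : 'I_m := widen_ord (c_le _) (tagged j).
pose J i : tors_idx c := existT _ P (cast_ord (esym cP) i).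
have posK i : pos (J i) = i by apply: val_inj.
have J_pos j : J (pos j) = j.
  case: j => pk i; have e := prime_powP pk i; subst pk.
  by congr existT; apply: val_inj.
have y_fin (y : forall j : tors_idx c, 'Z_(prime_pow (tag j))) :
  exists s : seq (tors_idx c), forall j, j \notin s -> y j = 0.
  exists [seq J i | i <- enum 'I_m] => j /negP[].
  by rewrite -(J_pos j) map_f ?mem_enum.
pose t (a : 'I_m -> int) : tors_part c :=
  @DSum _ (fun j : tors_idx c => 'Z_(prime_pow (tag j)) : zmodType)
    (fun j => (a (pos j))%:~R) (y_fin _).
have free0 (x : free_part c) : x = 0.
  have c0 : c 0%N = 0%N by rewrite /c; case: (p) p_gt1.
  by apply/ffunP => i; have := ltn_ord i; rewrite [X in (_ < X)%N]c0.
pose f (a : {ffun 'I_m -> int}) : free_part c * tors_part c := (0, t a).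
have intr0 (z : int) :
    z%:~R = 0 :> 'Z_(prime_pow P) <-> z%:~R = 0 :> F.
  have pZ : p \in [pchar 'Z_(prime_pow P)].
    by rewrite inE p_pr natr_Zp_eq0 /prime_pow /= expn1.
  have e : (z%:~R == 0 :> 'Z_(prime_pow P)) = (z%:~R == 0 :> F).
    by rewrite -(dvdz_pcharf pZ) -(dvdz_pcharf pF).
  by split=> /eqP z0; apply/eqP; rewrite ?e // -e.
exists f; split=> [a b|[x y]|a].
- rewrite /f; congr pair; first by rewrite subr0.
  by apply: dsumP => j /=; rewrite !ffunE rmorphB.
- pose v (j : tors_idx c) : nat := (y j : 'Z_(prime_pow (tag j))).
  exists [ffun i => Posz (v (J i))]; rewrite /f (free0 x); congr pair.
  by apply: dsumP => j /=; rewrite ffunE J_pos; apply: natr_Zp.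
split=> [/(congr1 snd) /= ta0 i|a0].
  have /(congr1 (fun y : dsum _ => y (J i))) /= := ta0.
  by rewrite posK => /intr0.
congr pair; apply: dsumP => j /=; rewrite -(J_pos j) /=.
by apply/intr0.
Qed.

(** The descent gives G a presentation with the same kernel as that of the sum of
    m copies of Z or of Z/p. *)
Lemma exists_codim (F : fieldType) (A : nuAlgType F) n :
  (0 < n)%N -> exists c, is_codim A n c.
Proof.
move=> n_gt0; have AF := @PZ_quot_char_torsion F A n n_gt0.
have [N [g0 /(spans_basis AF) [m [g gS gK]]]] := PZ_quot_spans n A.
pose f (a : {ffun 'I_m -> int}) := \sum_i g i *~ a i.
have fB : zmod_morphism f.
  move=> a b; rewrite /f -sumrB; apply: eq_bigr => i _.
  by rewrite !ffunE mulrzBr.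
have fS x : exists a, f a = x.
  have [a ->] := gS x; exists (finfun a).
  by apply: eq_bigr => i _; rewrite ffunE.
have [c [h [hB hS hK]]] :
    exists c, exists h, @presents F m (free_part c * tors_part c)%type h.
  have [[p pF]|noF] := pselect (exists p, p \in [pchar F]).
    exact: (presents_charp m pF).
  apply: presents_char0 => p; apply/negP => pF; apply: noF; by exists p.
exists c; apply: (zmod_isog_same_kernel fB hB fS hS) => a.
by rewrite hK /f gK.
Qed.

Theorem proposition1 (F : fieldType) (A : nuAlgType F) (n q : nat) :
  (0 < n)%N -> zero_or_prime_pow q -> ~ is_char F q -> codim A n q = 0%N.
Proof.
move=> n_gt0 qP nq; rewrite /codim.
case: pselect => [ex|[]]; last exact: exists_codim.
case: cid => c /= cA.
have VF := char_torsion_isog cA (@PZ_quot_char_torsion F A n n_gt0).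
apply/eqP; rewrite -leqn0 leqNgt; apply/negP => cq; apply: nq.
case: qP cq => [->|[p [[|k] [p_pr // _ ->]]]].
  exact: zero_char_of_free_part VF.
exact: prime_pow_char_of_tors_part VF p_pr.
Qed.
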